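(* Let $X_1, X_2, \ldots$ be i.i.d.\ random variables with $\mathbb{P}\{X_1 = 2^k\} = 2^{-k}$, $k \in \mathbb{N}=\{1,2,\ldots\}$. For $m \geq 1$ let $S_m = X_1 + \cdots + X_m$ and set $S_0 = 0$. For $n \geq 1$ let $X_{1n} \geq X_{2n} \geq \cdots \geq X_{nn}$ be the decreasing rearrangement of $X_1,\ldots,X_n$, and for $0 \leq r < n$ let $S_{n,r} = \sum_{k=r+1}^n X_{kn}$. Then for any integers $0 \leq r < n$, as $x \to \infty$, \[ \mathbb{P}\{ S_{n,r} > x\} \sim \frac{2^{(r+1)\{\log_2 x\}}}{x^{r+1}} \binom{n}{r+1} \left( 1 + \mathbb{P}\left\{ S_{n-r-1} > x\left(1 - 2^{-\{\log_2 x\}}\right)\right\} (2^{r+1}-1) \right). \] In particular, for any $0 < \delta < 1$, \[ \lim_{x \to \infty,\ \{\log_2 x\} > \delta} \mathbb{P}\{S_{n,r} > x\} \frac{x^{r+1}}{2^{(r+1)\{\log_2 x\}}} = \binom{n}{r+1}. \]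
   Context: $\{y\}$ denotes the fractional part of a real number $y$. The notation $f(x) \sim g(x)$ means $f(x)/g(x) \to 1$. $S_{n,r}$ is the $r$-trimmed sum (the sum with the $r$ largest observations removed); $S_{n,0} = S_n$. *)

(* Defs.v *)
From HB Require Import structures.
From mathcomp Require Import all_boot all_order all_algebra.
From mathcomp Require Import all_classical all_reals all_analysis.
Set Implicit Arguments. Unset Strict Implicit. Unset Printing Implicit Defensive.
Import Order.TTheory GRing.Theory Num.Theory.
Import numFieldNormedType.Exports.
Local Open Scope classical_set_scope.
Local Open Scope ring_scope.

Definition fracpart {R : realType} (y : R) : R := y - (Num.floor y)%:~R.

Definition log2 {R : realType} (x : R) : R := ln x / ln 2.

Definition mutually_independent {d : measure_display} {T : measurableType d}
  {R : realType} (P : probability T R) (X : nat -> T -> R) : Prop :=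
  forall (s : seq nat) (B : nat -> set R),
    uniq s -> (forall i, measurable (B i)) ->
    P (\bigcap_(i in [set i | i \in s]) (X i @^-1` B i)) =
    (\prod_(i <- s) P (X i @^-1` B i))%E.

(* S_m = X_1 + ... + X_m (indices shifted: X_1 is X 0), S_0 = 0 *)
Definition partial_sum {T : Type} {R : realType} (X : nat -> T -> R) (m : nat)
  : T -> R := fun w => \sum_(i < m) X i w.

Definition trimmed_sum {T : Type} {R : realType} (X : nat -> T -> R) (n r : nat)
  : T -> R := fun w =>
  \sum_(v <- drop r (sort (fun a b : R => b <= a) [seq X i w | i <- iota 0 n])) v.

(* Main.v *)
(* Let 2^(k+1) <= x < 2^(k+2) and y = x - 2^(k+1), so that
   y = x (1 - 2^(-{log2 x})). The trimmed sum exceeds x essentially in two ways.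
   Either r+1 observations exceed 2^(k+1), or exactly r+1 observations are at
   least 2^(k+1), the smallest of them equals 2^(k+1), and the other n-r-1 add
   up to more than y. In any other case at least r+2 observations are of order
   2^k, which has probability O(2^(-k(r+2))). Summing the two main
   probabilities over the (r+1)-subsets of the sample gives
   binom(n, r+1) 2^(-(k+1)(r+1)) (1 + (2^(r+1) - 1) P(S_(n-r-1) > y)) up to
   a relative error O(2^(-k)). *)
Require Import Defs.
From HB Require Import structures.
From mathcomp Require Import all_boot all_order all_algebra.
From mathcomp Require Import ring lra zify.
From mathcomp Require Import all_classical all_reals all_analysis.
Import Order.TTheory GRing.Theory Num.Theory.
Import numFieldNormedType.Exports.
Local Open Scope classical_set_scope.
Local Open Scope ring_scope.

(** * Trimmed sums as minima of sums over subsets *)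

(** Since the cardinals agree, [c] may be subtracted from every term. The sum over [D] then collects
    all negative terms and no positive one. *)
Lemma ler_sum_lowest (R : realDomainType) (n : nat) (v : 'I_n -> R) (c : R)
    (D B : {set 'I_n}) :
  #|D| = #|B| -> (forall i, i \in D -> v i <= c) ->
  (forall i, i \notin D -> c <= v i) ->
  \sum_(i in D) v i <= \sum_(i in B) v i.
Proof.
move=> DB Dc cD.
have shift (E : {set 'I_n}) :
    \sum_(i in E) v i = \sum_(i in E) (v i - c) + c *+ #|E|.
  by rewrite -sumr_const -big_split; apply: eq_bigr => i _ /=; rewrite subrK.
rewrite !shift DB lerD2r.
(* On [D] the truncation [g] is [v - c], off [D] it vanishes. *)
pose g i := Num.min (v i - c) 0.
have -> : \sum_(i in D) (v i - c) = \sum_i g i.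
  rewrite [RHS](bigID [in D]) /= [X in _ = _ + X]big1 ?addr0 => [|i iD].
    by apply: eq_bigr => i iD; rewrite /g min_l// subr_le0 Dc.
  by rewrite /g min_r// subr_ge0 cD.
rewrite (bigID [in B]) /= -[leRHS]addr0; apply: lerD.
  by apply: ler_sum => i _; rewrite /g ge_min lexx.
by apply: sumr_le0 => i _; rewrite /g ge_min lexx orbT.
Qed.

Lemma exists_card_subset (I : finType) (E : {set I}) (k : nat) :
  (k <= #|E|)%N -> exists2 B : {set I}, B \subset E & #|B| = k.
Proof.
move=> kE; have := bin_gt0 #|E| k; rewrite kE -cards_draws => /card_gt0P[B].
by rewrite inE => /andP[? /eqP]; exists B.
Qed.

(** The trimmed sum is the least sum over [n - r] indices, attained at the smallest values. This
    form eliminates sorting from everything that follows. *)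
Lemma lt_trimmed_sumP (T : Type) (R : realType) (X : nat -> T -> R) (n r : nat)
    (w : T) (x : R) : (r < n)%N ->
  x < trimmed_sum X n r w <->
  forall B : {set 'I_n}, #|B| = (n - r)%N -> x < \sum_(i in B) X i w.
Proof.
move=> rn; pose v (i : 'I_n) := X i w.
pose ge_R := fun a b : R => b <= a.
(* Indices are sorted instead of values, so that the tail left by [drop] is a set of indices even
   when values coincide. *)
pose J := sort (relpre v ge_R) (enum 'I_n).
have JE : sort ge_R [seq X i w | i <- iota 0 n] = map v J.
  rewrite -val_enum_ord -map_comp -sort_map; congr sort.
have permJ : perm_eq J (enum 'I_n) by rewrite perm_sort.
have uJ : uniq J by rewrite (perm_uniq permJ) enum_uniq.
have sJ : size J = n by rewrite (perm_size permJ) size_enum_ord.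
have inJ i : i \in J by rewrite (perm_mem permJ) mem_enum.
pose D := [set i in drop r J]%SET.
have -> : trimmed_sum X n r w = \sum_(i in D) v i.
  rewrite /trimmed_sum -/ge_R JE -map_drop big_map big_uniq ?drop_uniq//.
  by apply: eq_bigl => i; rewrite inE.
have cD : #|D| = (n - r)%N.
  by rewrite cardsE; move/card_uniqP : (drop_uniq r uJ) => ->; rewrite size_drop sJ.
(* The threshold is the value at the head of [drop r J], a list that is nonempty because [r < n]. *)
have [c Dc cDc] : exists2 c, (forall i, i \in D -> v i <= c) &
                             (forall i, i \notin D -> c <= v i).
  have tr : transitive (relpre v ge_R) by move=> a b e /= h1 h2; exact: le_trans h2 h1.
  have : sorted (relpre v ge_R) J.
    by apply: sort_sorted => a b; rewrite /= /ge_R le_total.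
  rewrite sorted_pairwise// -{1}(cat_take_drop r J) pairwise_cat.
  move=> /and3P[/allrelP all_td _].
  case dE : (drop r J) all_td => [|a J'] all_td.
    have := size_drop r J; rewrite dE sJ /= => /esym/eqP.
    by rewrite subn_eq0 leqNgt rn.
  move=> /= /andP[/allP aJ' _]; exists (v a) => i; rewrite inE dE.
    by rewrite inE => /predU1P[->|/aJ'].
  move=> iNd; have : i \in take r J.
    by have := inJ i; rewrite -{1}(cat_take_drop r J) mem_cat dE (negbTE iNd) orbF.
  by move=> it; apply: (all_td i a it); rewrite inE eqxx.
split=> [xD B cB|]; last by apply.
by rewrite (lt_le_trans xD)// (@ler_sum_lowest _ _ v c D B)// cD.
Qed.

(** * Dyadic values *)

(** The powers [2, ..., 2^j]: a finite set, so that laws of truncated observations reduce to finite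
    sums over exponents. *)
Definition dyads (R : realType) (j : nat) : set R :=
  [set v | exists2 k, (k < j)%N & v = 2 ^+ k.+1].

Definition all_dyads (R : realType) : set R := [set v | exists k, v = 2 ^+ k.+1].

Lemma dyads_le {R : realType} j (v : R) : dyads R j v -> v <= 2 ^+ j.
Proof. by move=> [k kj ->]; rewrite ler_weXn2l// ler1n. Qed.

Lemma not_dyads_ge {R : realType} j (v : R) :
  all_dyads R v -> ~ dyads R j v -> 2 ^+ j.+1 <= v.
Proof.
move=> [k ->] nd; rewrite ler_weXn2l ?ler1n// ltnS leqNgt.
by apply/negP => kj; apply: nd; exists k.
Qed.

Lemma dyads_sub {R : realType} i j (v : R) : (i <= j)%N -> dyads R i v -> dyads R j v.
Proof. by move=> ij [k ki ->]; exists k => //; exact: leq_trans ij. Qed.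

Lemma dyadsS {R : realType} j (v : R) : dyads R j.+1 v <-> dyads R j v \/ v = 2 ^+ j.+1.
Proof.
split=> [[k]|[[k kj ->]|->]]; last 2 first.
- by exists k => //; exact: leqW.
- by exists j.
by rewrite ltnS leq_eqVlt => /predU1P[->|kj] ->; [right|left; exists k].
Qed.

(* [A] carries exactly the values that are at least [2 ^+ k.+1]; the two
   alternatives are those of the header, for [A] of cardinal [r.+1]. *)
Definition top_profile {R : realType} {n : nat} (v : 'I_n -> R) (k : nat)
    (A : {set 'I_n}) (y : R) : Prop :=
  (forall i, i \notin A -> dyads R k (v i)) /\
  ((forall i, i \in A -> ~ dyads R k.+1 (v i)) \/
   ((forall i, i \in A -> ~ dyads R k (v i)) /\
    ~ (forall i, i \in A -> ~ dyads R k.+1 (v i)) /\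
    y < \sum_(i in ~: A) v i)).

(** * Deterministic comparison of the trimmed sum with the profile of large values *)

Section profile.
Context {R : realType} {n r : nat} (v : 'I_n -> R) (k : nat) (x : R).
Context (rn : (r < n)%N).
Context (vd : forall i, all_dyads R (v i)).
Context (xk : 2 ^+ k.+1 <= x < 2 ^+ k.+2).

Let v0 i : 0 <= v i. Proof. by have [j ->] := vd i; rewrite exprn_ge0. Qed.

Let sum_sub (A B : {set 'I_n}) : A \subset B ->
  \sum_(i in A) v i <= \sum_(i in B) v i.
Proof.
move=> AB; rewrite [leRHS](big_setID A) /= (finset.setIidPr AB) /= lerDl.
exact: sumr_ge0.
Qed.

(** [A] and [B] meet because [(r+1) + (n-r) > n]. In the first alternative one common index already
    contributes at least [2^(k+2) > x]. In the second, two common indices do so together, while a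
    single one forces [B] to contain [~: A], whose sum exceeds [x - 2^(k+1)]. *)
Lemma top_profile_gt (A : {set 'I_n}) : #|A| = r.+1 ->
  top_profile v k A (x - 2 ^+ k.+1) ->
  forall B : {set 'I_n}, #|B| = (n - r)%N -> x < \sum_(i in B) v i.
Proof.
move: xk => /andP[kx xk2] cA [Ac prof] B cB.
have AL i : i \in A -> 2 ^+ k.+1 <= v i.
  move=> iA; apply: not_dyads_ge => //; case: prof => [/(_ i iA) h|[h _]]; last exact: h.
  by move=> /(dyads_sub _ _ _ (leqnSn _)).
have cU : (#|A :|: B| <= n)%N by rewrite -[leqRHS]card_ord max_card.
have cI : (0 < #|A :&: B|)%N by move: cU; rewrite cardsU cA cB; lia.
have [a aAB] : exists a, a \in A :&: B by apply/card_gt0P.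
have /andP[aA aB] : (a \in A) && (a \in B) by rewrite -finset.in_setI.
case: prof => [AG|[_ [_ yA]]].
  apply: (lt_le_trans xk2); rewrite (bigD1 a)//= -[leLHS]addr0 lerD ?sumr_ge0//.
  by apply: not_dyads_ge => //; exact: AG.
have [cI1|cI2] := leqP #|A :&: B| 1.
  have cI1' : #|A :&: B| = 1%N by lia.
  have BA : B :\: A = ~: A.
    apply/eqP; rewrite eqEcard; apply/andP; split.
      by apply/fintype.subsetP => i; rewrite !inE => /andP[].
    have := cardsC A; have := cardsID A B.
    by rewrite finset.setIC cI1' cA cB card_ord; lia.
  rewrite (big_setID A) BA /= finset.setIC.
  have /cards1P[b bE] : #|A :&: B| == 1%N by rewrite cI1'.
  move: (aAB); rewrite bE inE => /eqP ab; rewrite big_set1 -ab.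
  by rewrite ltrBlDl in yA; rewrite (lt_le_trans yA)// lerD2r AL.
have [b /andP[ba bAB]] : exists b, (b != a) && (b \in A :&: B).
  have := cardsD1 a (A :&: B); rewrite aAB => h.
  have : (0 < #|(A :&: B) :\ a|)%N by lia.
  by case/card_gt0P => b; rewrite finset.in_setD1; exists b.
have /andP[bA bB] : (b \in A) && (b \in B) by rewrite -finset.in_setI.
apply: (lt_le_trans xk2); rewrite (bigD1 a)//= (bigD1 b) ?bB//= addrA.
rewrite -[leLHS]addr0 lerD ?sumr_ge0// exprS.
by move: (AL a aA) (AL b bA); lra.
Qed.

(** [H] and [L] collect the values above [2^(k-n)] and above [2^k]. If [H] has at most [r+1]
    elements, then [L] must have [r+1] as well, so [L = H], and this set serves as [A]. *)
Lemma gt_top_profile : (n <= k)%N ->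
  (forall B : {set 'I_n}, #|B| = (n - r)%N -> x < \sum_(i in B) v i) ->
  (exists2 A : {set 'I_n}, #|A| = r.+2 &
     forall i, i \in A -> ~ dyads R (k - n) (v i)) \/
  (exists2 A : {set 'I_n}, #|A| = r.+1 & top_profile v k A (x - 2 ^+ k.+1)).
Proof.
move: xk => /andP[kx xk2] nk tx.
pose H : {set 'I_n} := [set i | ~~ `[< dyads R (k - n) (v i) >]]%SET.
pose L : {set 'I_n} := [set i | ~~ `[< dyads R k (v i) >]]%SET.
have inH i : i \in H -> ~ dyads R (k - n) (v i).
  by rewrite inE => /asboolPn.
have inHC i : i \notin H -> dyads R (k - n) (v i).
  by rewrite inE negbK => /asboolP.
have inL i : i \in L -> ~ dyads R k (v i) by rewrite inE => /asboolPn.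
have inLC i : i \notin L -> dyads R k (v i) by rewrite inE negbK => /asboolP.
have LH : L \subset H.
  apply/fintype.subsetP => i iL; rewrite inE; apply/asboolPn => h.
  by apply: (inL i iL); apply: dyads_sub h; exact: leq_subr.
have tx' (B : {set 'I_n}) : (n - r <= #|B|)%N -> x < \sum_(i in B) v i.
  move=> /exists_card_subset[B' B'B cB'].
  by apply: (lt_le_trans (tx _ cB')); exact: sum_sub.
have cHC := cardsC H; rewrite card_ord in cHC.
(* The cutoff [k - n] is chosen for this bound: at most [n <= 2^n] terms, each at most [2^(k-n)]. *)
have sumHC : \sum_(i in ~: H) v i <= 2 ^+ k.
  apply: (@le_trans _ _ (\sum_(i in ~: H) 2 ^+ (k - n))).
    by apply: ler_sum => i; rewrite inE => /inHC /dyads_le.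
  rewrite sumr_const -[leLHS]mulr_natl -[in leRHS](subnKC nk) exprD ler_wpM2r ?exprn_ge0//.
  rewrite -natrX ler_nat; apply: leq_trans (ltnW (ltn_expl n (ltnSn 1))).
  by rewrite -[leqRHS](card_ord n) max_card.
have k0 : 0 < 2 ^+ k :> R by rewrite exprn_gt0.
rewrite exprS in kx; rewrite [2 ^+ k.+2]exprS in xk2.
have [cL|cL] := leqP r.+2 #|H|.
  by left; have [A AH cA] := exists_card_subset _ _ _ cL; exists A => // i /(fintype.subsetP AH) /inH.
have [cLr|cLr] := leqP r.+1 #|L|.
  have LHE : L = H.
    by apply/eqP; rewrite eqEcard LH andTb; apply: leq_trans cLr; rewrite -ltnS.
  have cLE : #|L| = r.+1 by rewrite LHE in cLr *; apply/eqP; rewrite eqn_leq cLr andbT.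
  right; exists L => //; split=> //.
  have [?|nG] := pselect (forall i, i \in L -> ~ dyads R k.+1 (v i)); [by left|right].
  split=> //; split=> //.
  (* Some index of [L] has value exactly [2^(k+1)]. Together with [~: L] it forms a set of [n - r]
     indices, which bounds the remaining sum from below. *)
  have [a] : exists a, ~ (a \in L -> ~ dyads R k.+1 (v a)) by apply/existsNP.
  move=> /not_implyP[aL /contrapT /dyadsS [/(inL a aL)//|va]].
  have aLC : a \notin ~: L by rewrite inE aL.
  have := tx' (a |: ~: L); rewrite cardsU1 aLC big_setU1//= va -ltrBlDl; apply.
  by rewrite leq_subLR addnA addn1 -cLE LHE cHC.
(* Now [L] has at most [r] elements. Either [~: H] alone has [n - r] indices, or it does so with one
   more index of value at most [2^k]; the sum is then at most [2^(k+1) <= x]. *)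
exfalso.
have [cHr|cHr] := leqP #|H| r.
  have := tx' (~: H) ltac:(lia); lra.
have [a /andP[aH aL]] : exists a, (a \in H) && (a \notin L).
  have : (0 < #|H :\: L|)%N by rewrite cardsDS//; lia.
  by case/card_gt0P => a; rewrite inE => /andP[? ?]; exists a; apply/andP.
have aHC : a \notin ~: H by rewrite inE aH.
have := tx' (a |: ~: H); rewrite cardsU1 aHC big_setU1//=.
rewrite leq_subLR addnA addn1 -[X in (X <= _)%N -> _]cHC leq_add2r -ltnS => /(_ cL).
by move=> h; have := lt_le_trans h (lerD (dyads_le _ _ (inLC a aL)) sumHC); lra.
Qed.

End profile.

(** * Real-valued probabilities of events *)

Section fine_probability.
Context {d : measure_display} {T : measurableType d} {R : realType}.
Variable P : probability T R.

Local Notation pr A := (fine (P A)).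

Lemma prE (A : set T) : measurable A -> P A = (pr A)%:E.
Proof. by move=> mA; rewrite fineK// fin_num_measure. Qed.

Lemma pr_ge0 (A : set T) : 0 <= pr A.
Proof. exact: fine_ge0. Qed.

Lemma pr_le1 (A : set T) : measurable A -> pr A <= 1.
Proof. by move=> mA; rewrite -lee_fin -prE// probability_le1. Qed.

Lemma pr_setT : pr setT = 1.
Proof. by rewrite probability_setT. Qed.

Lemma pr_le (A B : set T) : measurable A -> measurable B -> A `<=` B -> pr A <= pr B.
Proof. by move=> mA mB AB; rewrite -lee_fin -!prE// le_measure ?inE. Qed.

Lemma pr_setU (A B : set T) : measurable A -> measurable B ->
  (forall w, A w -> B w -> False) -> pr (A `|` B) = pr A + pr B.
Proof.
move=> mA mB AB; apply: EFin_inj; rewrite EFinD -!prE//; last exact: measurableU.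
by rewrite measureU//; apply/seteqP; split => // w [] /AB.
Qed.

Lemma pr_setU_le (A B : set T) : measurable A -> measurable B ->
  pr (A `|` B) <= pr A + pr B.
Proof.
move=> mA mB; have -> : A `|` B = A `|` (B `\` A) by rewrite setDE setUIr setUv setIT.
have mD : measurable (B `\` A) by exact: measurableD.
by rewrite pr_setU//; [rewrite lerD2l pr_le// => w []|move=> w ? []].
Qed.

Lemma pr_setC (A : set T) : measurable A -> pr (~` A) = 1 - pr A.
Proof.
by move=> mA; rewrite -pr_setT -(setvU A) pr_setU ?addrK//; exact: measurableC.
Qed.

Lemma measurable_bigsetU_seq {I : choiceType} (s : seq I) (F : I -> set T) :
  (forall i, measurable (F i)) -> measurable (\bigcup_(i in [set` s]) F i).
Proof. by move=> mF; rewrite bigcup_seq; exact: bigsetU_measurable. Qed.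

Lemma pr_bigcup_seq {I : choiceType} (s : seq I) (F : I -> set T) : uniq s ->
  (forall i, measurable (F i)) -> (forall i j w, F i w -> F j w -> i = j) ->
  pr (\bigcup_(i in [set` s]) F i) = \sum_(i <- s) pr (F i).
Proof.
move=> us mF Fd; elim: s us => [|i s IH] /=.
  by rewrite set_nil bigcup_set0 big_nil measure0.
move=> /andP[is_ us]; rewrite bigcup_seq !big_cons -bigcup_seq -IH// pr_setU//.
  exact: measurable_bigsetU_seq.
by move=> w Fi [j /= js] /(Fd _ _ _ Fi) ij; rewrite ij js in is_.
Qed.

Lemma pr_bigcup_seq_le {I : choiceType} (s : seq I) (F : I -> set T) :
  (forall i, measurable (F i)) ->
  pr (\bigcup_(i in [set` s]) F i) <= \sum_(i <- s) pr (F i).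
Proof.
move=> mF; elim: s => [|i s IH] /=.
  by rewrite set_nil bigcup_set0 big_nil measure0.
rewrite bigcup_seq !big_cons -bigcup_seq (le_trans (pr_setU_le _ _ _ _))//.
  exact: measurable_bigsetU_seq.
by rewrite lerD2l.
Qed.

End fine_probability.

(** * Measurability of dyadic sets and the recursion for truncated sums *)

Lemma measurable_dyads (R : realType) j : measurable (dyads R j).
Proof.
have -> : dyads R j = \bigcup_(k in [set` iota 0 j]) [set 2 ^+ k.+1].
  apply/seteqP; split => [v [k kj ->]|v [k /=]]; first by exists k; rewrite //= mem_iota.
  by rewrite mem_iota => kj ->; exists k.
by apply: measurable_bigsetU_seq => k; exact: measurable_set1.
Qed.

Lemma measurable_all_dyads (R : realType) : measurable (all_dyads R).
Proof.
have -> : all_dyads R = \bigcup_k [set 2 ^+ k.+1].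
  by apply/seteqP; split => [v [k ->]|v [k _ ->]]; exists k.
by apply: bigcup_measurable => k _; exact: measurable_set1.
Qed.

Lemma exists_expn2_gt {R : realType} (z : R) : exists j, z < 2 ^+ j.
Proof.
exists (Num.bound `|z|); apply: (le_lt_trans (ler_norm z)).
apply: (lt_le_trans (archi_boundP (normr_ge0 z))).
by rewrite -natrX ler_nat ltnW// ltn_expl.
Qed.

(* The probability that [l] independent observations all lie in [dyads R j] and
   add up to more than [y], computed by conditioning on the first of them. *)
Fixpoint dyads_sum_tail {R : realType} (j l : nat) (y : R) : R :=
  if l is l'.+1
  then \sum_(k < j) (2 ^+ k.+1)^-1 * dyads_sum_tail j l' (y - 2 ^+ k.+1)
  else (y < 0)%R%:R.

(** * Law of one observation, boxes and truncated sums *)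

Section petersburg.
Context {R : realType} {d : measure_display} {T : measurableType d}.
Context {P : probability T R} {X : nat -> {RV P >-> R}}.
Context (hdist : forall (i k : nat), (0 < k)%N ->
  P (X i @^-1` [set 2 ^+ k]) = ((2 ^+ k)^-1)%:E).
Context (hind : mutually_independent P (fun i => (X i : T -> R))).

Local Notation pr A := (fine (P A)).

Lemma measurable_RV_preimage i (B : set R) : measurable B -> measurable (X i @^-1` B).
Proof. by move=> mB; rewrite -[X in measurable X]setTI; exact: measurable_funP. Qed.

Lemma pr_dyads i j : pr (X i @^-1` dyads R j) = 1 - (2 ^+ j)^-1.
Proof.
elim: j => [|j IH].
  rewrite expr0 invr1 subrr (_ : dyads R 0 = set0) ?preimage_set0 ?measure0//.
  by apply/seteqP; split => // v [].
have -> : dyads R j.+1 = dyads R j `|` [set 2 ^+ j.+1].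
  by apply/seteqP; split => v /dyadsS.
rewrite preimage_setU pr_setU ?IH ?hdist//=.
- by rewrite exprS invfM; lra.
  by apply: measurable_RV_preimage; exact: measurable_dyads.
move=> w /= hd he; have := dyads_le _ _ hd; rewrite he leNgt.
by rewrite ltr_eXn2l ?ltr1n// ltnSn.
Qed.

Lemma pr_not_dyads i j : pr (X i @^-1` (~` dyads R j)) = (2 ^+ j)^-1.
Proof.
have mD : measurable (X i @^-1` dyads R j).
  by apply: measurable_RV_preimage; exact: measurable_dyads.
by rewrite preimage_setC pr_setC// pr_dyads opprB addrC subrK.
Qed.

(** Only the masses of the powers of two are given, but they add up to one: the event is contained
    in the complement of [dyads R j] for every [j], of probability [2^-j]. *)
Lemma pr_not_all_dyads i : pr (X i @^-1` (~` all_dyads R)) = 0.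
Proof.
apply/eqP; rewrite eq_le pr_ge0 andbT; apply/ler_addgt0Pr => e e0.
have [j je] := exists_expn2_gt e^-1.
rewrite -[ltRHS]invrK ltf_pV2 ?posrE ?invr_gt0 ?exprn_gt0// in je.
rewrite -(pr_not_dyads i j) in je; rewrite add0r; apply: ltW; apply: le_lt_trans je.
apply: pr_le.
- apply: measurable_RV_preimage; apply: measurableC; exact: measurable_all_dyads.
- apply: measurable_RV_preimage; apply: measurableC; exact: measurable_dyads.
by move=> w /= h [k _ hk]; apply: h; exists k.
Qed.

Definition box (s : seq nat) (B : nat -> set R) : set T :=
  \bigcap_(i in [set` s]) X i @^-1` B i.

(** The restriction to [dyads R j] leaves finitely many outcomes, so that point masses and
    independence alone determine the probability. *)
Definition dyads_sum_gt (j : nat) (s : seq nat) (y : R) : set T :=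
  [set w | (forall i, i \in s -> dyads R j (X i w)) /\ y < \sum_(i <- s) X i w].

Lemma measurable_box s B : (forall i, measurable (B i)) -> measurable (box s B).
Proof.
by move=> mB; apply: bigcap_measurableType => i _; exact: measurable_RV_preimage.
Qed.

Lemma measurable_sum_gt {I : Type} (s : seq I) (f : I -> nat) (y : R) :
  measurable [set w | y < \sum_(i <- s) X (f i) w].
Proof.
have ms : measurable_fun [set: T] (fun w => \sum_(i <- s) X (f i) w).
  by apply: measurable_sum => i.
rewrite (_ : [set w | _] = setT `&` (fun w => \sum_(i <- s) X (f i) w) @^-1` `]y, +oo[).
  exact: ms.
by apply/seteqP; split => w /=; rewrite in_itv/= andbT; tauto.
Qed.

Lemma measurable_dyads_sum_gt j s y : measurable (dyads_sum_gt j s y).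
Proof.
have -> : dyads_sum_gt j s y =
    box s (fun=> dyads R j) `&` [set w | y < \sum_(i <- s) X (id i) w] by [].
apply: measurableI; last exact: measurable_sum_gt.
by apply: measurable_box => _; exact: measurable_dyads.
Qed.

Lemma pr_box s B : uniq s -> (forall i, measurable (B i)) ->
  pr (box s B) = \prod_(i <- s) pr (X i @^-1` B i).
Proof.
move=> us mB; apply: EFin_inj; rewrite -prE; last exact: measurable_box.
rewrite [LHS]hind//; elim: s {us} => [|i s IH]; first by rewrite !big_nil.
rewrite !big_cons EFinM IH -prE//.
exact: measurable_RV_preimage.
Qed.

(* Gives at once the independence of the box from the sum over [s] and the fact
   that the law of this sum depends only on [size s]. *)
Lemma pr_box_dyads_sum_gt j s s0 B y : uniq (s ++ s0) -> (forall i, measurable (B i)) ->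
  pr (box s0 B `&` dyads_sum_gt j s y) =
  (\prod_(i <- s0) pr (X i @^-1` B i)) * dyads_sum_tail j (size s) y.
Proof.
elim: s s0 B y => [|i s IH] s0 B y /= us mB.
  rewrite -pr_box//; case: (ltP y 0) => y0.
    rewrite (_ : dyads_sum_gt _ _ _ = setT) ?setIT ?mulr1//.
    by apply/seteqP; split => w // _; split; rewrite ?big_nil.
  rewrite (_ : dyads_sum_gt _ _ _ = set0) ?setI0 ?mulr0 ?measure0//.
  by apply/seteqP; split => w // -[_]; rewrite big_nil ltNge y0.
have /andP[/norP[is_ is0] us'] : ~~ ((i \in s) || (i \in s0)) && uniq (s ++ s0).
  by rewrite -mem_cat.
(* Conditioning on observation [i] being [2^(k+1)] amounts to adding [i] to the box with a one-point
   side; hence the induction over all [s0] and [B]. *)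
pose B' (k : nat) l := if l == i then [set (2 : R) ^+ k.+1] else B l.
have mB' k l : measurable (B' k l) by rewrite /B'; case: ifP => // _; exact: measurable_set1.
pose F k := box (i :: s0) (B' k) `&` dyads_sum_gt j s (y - 2 ^+ k.+1).
have mF k : measurable (F k).
  by apply: measurableI; [exact: measurable_box|exact: measurable_dyads_sum_gt].
have FX k w : F k w -> X i w = 2 ^+ k.+1.
  by move=> [/(_ i) h _]; have := h (mem_head _ _); rewrite /= /B' eqxx.
have -> : box s0 B `&` dyads_sum_gt j (i :: s) y = \bigcup_(k in [set` iota 0 j]) F k.
  apply/seteqP; split => w.
    move=> [hb [hd]]; rewrite big_cons.
    have [k kj Xk] := hd i (mem_head _ _); rewrite Xk -ltrBlDl => hy.
    exists k; first by rewrite /= mem_iota.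
    split; last by split => // l ls; apply: hd; rewrite inE ls orbT.
    move=> l /=; rewrite inE /B' => /predU1P[->|ls0]; first by rewrite eqxx.
    by case: eqP => [->|_]; [|exact: hb].
  move=> [k /=]; rewrite mem_iota /= add0n => kj Fk.
  have Xk := FX _ _ Fk; case: Fk => hb [hd hy]; split.
    move=> l /= ls0; have := hb l; rewrite /= inE ls0 orbT /B' => /(_ isT).
    by case: eqP => // li; rewrite -li ls0 in is0.
  split=> [l|]; last by rewrite big_cons Xk -ltrBlDl.
  by rewrite inE => /predU1P[->|/hd//]; exists k.
rewrite pr_bigcup_seq//; first last.
- move=> k k' w /FX Xk /FX; rewrite Xk.
  by move/ieexprIn => /(_ ltac:(lra)) /(_ ltac:(lra)) [].
- exact: iota_uniq.
rewrite -{1}(subn0 j) -/(index_iota 0 j) big_mkord mulr_sumr; apply: eq_bigr => k _.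
rewrite IH//; last by rewrite uniq_catC /= mem_cat negb_or is0 is_ uniq_catC.
rewrite big_cons /B' eqxx hdist//= mulrCA !mulrA; congr (_ * _ * _).
by apply: eq_big_seq => l ls0; case: eqP => // li; rewrite -li ls0 in is0.
Qed.

(** * Subsets of the sample and the probability of a top profile *)

(** Links the sets of ordinals in the profiles to the lists of naturals in the independence
    hypothesis. *)
Definition ord_seq {n : nat} (A : {set 'I_n}) : seq nat := [seq val i | i <- enum A].

Lemma mem_ord_seq {n : nat} (A : {set 'I_n}) (i : 'I_n) :
  (val i \in ord_seq A) = (i \in A).
Proof. by rewrite mem_map ?mem_enum//; exact: val_inj. Qed.

Lemma uniq_ord_seqC {n : nat} (A : {set 'I_n}) : uniq (ord_seq (~: A) ++ ord_seq A).
Proof.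
rewrite cat_uniq !map_inj_uniq ?enum_uniq//=; try exact: val_inj.
rewrite andbT; apply/hasPn => _ /mapP[i + ->]; rewrite mem_enum => iA.
by rewrite mem_ord_seq inE iA.
Qed.

Lemma size_ord_seq {n : nat} (A : {set 'I_n}) : size (ord_seq A) = #|A|.
Proof. by rewrite size_map cardE. Qed.

Lemma prod_ord_seq {n : nat} (A : {set 'I_n}) (c : R) :
  \prod_(i <- ord_seq A) c = c ^+ #|A|.
Proof. by rewrite big_map big_enum /= prodr_const. Qed.

Lemma sum_ord_seq {n : nat} (A : {set 'I_n}) (v : nat -> R) :
  \sum_(i <- ord_seq A) v i = \sum_(i in A) v i.
Proof. by rewrite big_map big_enum. Qed.

Lemma pr_setD (A B : set T) : measurable A -> measurable B -> B `<=` A ->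
  pr (A `\` B) = pr A - pr B.
Proof.
move=> mA mB BA; have mD : measurable (A `\` B) by exact: measurableD.
have := pr_setU P B (A `\` B) mB mD.
rewrite setDUK// => ->; last by move=> w ? [].
by rewrite addrC addKr.
Qed.

Lemma measurable_not_dyads (j : nat) : measurable (~` dyads R j).
Proof. by apply: measurableC; exact: measurable_dyads. Qed.

(** Dyadic values are positive, so the level [-1] imposes no condition, and a box of small values
    becomes a special sum event. *)
Lemma dyads_sum_gtN1 j s : dyads_sum_gt j s (-1) = box s (fun=> dyads R j).
Proof.
apply/seteqP; split => w; first by case.
move=> h; split=> //; rewrite (lt_le_trans (ltrN10 _))// big_seq sumr_ge0// => i /h.
by move=> [k _ ->]; rewrite exprn_ge0.
Qed.

Section trimmed_asymptotics.
Context {n r : nat}.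

Definition top_event (k : nat) (y : R) (A : {set 'I_n}) : set T :=
  [set w | top_profile (fun i : 'I_n => X i w) k A y].

Let top_box (j : nat) (A : {set 'I_n}) := box (ord_seq A) (fun=> ~` dyads R j).
Let rest k (A : {set 'I_n}) y := dyads_sum_gt k (ord_seq (~: A)) y.

Let boxP (A : {set 'I_n}) (B : set R) w :
  box (ord_seq A) (fun=> B) w <-> forall i : 'I_n, i \in A -> B (X i w).
Proof.
split=> [h i iA|h _ /mapP[i + ->]]; first by apply: (h (val i)); rewrite /= mem_ord_seq.
by rewrite mem_enum => /h.
Qed.

(** Both alternatives are expressed by boxes on [A] and sum events on its complement, whose joint
    probabilities factor. The negated clause of the second becomes a difference of nested events. *)
Let top_eventE k y A : top_event k y A =
  (top_box k.+1 A `&` rest k A (-1)) `|`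
  ((top_box k A `&` rest k A y) `\` (top_box k.+1 A `&` rest k A y)).
Proof.
have restP z w : rest k A z w <->
    (forall i, i \notin A -> dyads R k (X i w)) /\ z < \sum_(i in ~: A) X i w.
  rewrite /rest /dyads_sum_gt /= (sum_ord_seq _ (fun i => X i w)).
  split=> -[h1 h2]; split=> // i.
    by move=> iA; apply: h1; rewrite mem_ord_seq inE.
  by move=> /mapP[l + ->]; rewrite mem_enum inE => /h1.
have restN w : rest k A (-1) w <-> (forall i, i \notin A -> dyads R k (X i w)).
  rewrite /rest dyads_sum_gtN1 boxP.
  by split=> h i; [move=> iA; apply: h; rewrite inE|rewrite inE => /h].
apply/seteqP; split => w.
  move=> [Ac [AG|[AL [nAG yA]]]].
    by left; split; [apply/boxP|apply/restN].
  right; split; last by move=> -[/boxP].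
  by split; [apply/boxP|apply/restP].
move=> [[/boxP AG /restN Ac]|[[/boxP AL Ay] nAG]]; first by split=> //; left.
have [Ac yA] := (restP _ _).1 Ay.
split=> //; right; split=> //; split=> // AG.
by apply: nAG; split=> //; apply/boxP.
Qed.

Let mbox j A : measurable (top_box j A).
Proof. by apply: measurable_box => _; exact: measurable_not_dyads. Qed.

Let mrest k A y : measurable (rest k A y).
Proof. exact: measurable_dyads_sum_gt. Qed.

Lemma measurable_top_event k y A : measurable (top_event k y A).
Proof.
rewrite top_eventE; apply: measurableU; first exact: measurableI.
by apply: measurableD; exact: measurableI.
Qed.

(** The two parts are disjoint. The factor [2^(r+1) - 1] comes from the difference, as doubling the
    tail [2^-(k+1)] of each of the [r+1] observations gives [2^-k]. *)
Lemma pr_top_event k y (A : {set 'I_n}) : #|A| = r.+1 ->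
  pr (top_event k y A) = ((2 ^+ k.+1)^-1) ^+ r.+1 *
    (dyads_sum_tail k (n - r.+1) (-1) +
     (2 ^+ r.+1 - 1) * dyads_sum_tail k (n - r.+1) y).
Proof.
move=> cA.
have sub : top_box k.+1 A `<=` top_box k A.
  by move=> w /boxP h; apply/boxP => i /h hG /(dyads_sub _ _ _ (leqnSn k)).
have cAC : #|~: A| = (n - r.+1)%N by rewrite -[n in RHS]card_ord -(cardsC A) cA addKn.
have prb j z : pr (top_box j A `&` rest k A z) =
    ((2 ^+ j)^-1) ^+ r.+1 * dyads_sum_tail k (n - r.+1) z.
  rewrite pr_box_dyads_sum_gt ?uniq_ord_seqC// => [|_]; last exact: measurable_not_dyads.
  rewrite size_ord_seq cAC -cA -prod_ord_seq; congr (_ * _).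
  by apply: eq_bigr => i _; exact: pr_not_dyads.
rewrite top_eventE pr_setU; first last.
- by move=> w [bG _] [[_ ry]] []; split.
- by apply: measurableD; exact: measurableI.
- exact: measurableI.
rewrite pr_setD; [|exact: measurableI|exact: measurableI|exact: setSI].
rewrite !prb.
have -> : (2 ^+ k)^-1 = 2 * (2 ^+ k.+1)^-1 :> R.
  by rewrite exprS invfM mulrA divff ?mul1r// pnatr_eq0.
by rewrite exprMn; ring.
Qed.

End trimmed_asymptotics.

(** * Comparison of truncated and full partial sums *)

Lemma dyads_sum_tailE j l y : dyads_sum_tail j l y = pr (dyads_sum_gt j (iota 0 l) y).
Proof.
have := @pr_box_dyads_sum_gt j (iota 0 l) [::] (fun=> setT) y.
rewrite cats0 iota_uniq big_nil => /(_ isT (fun=> measurableT)).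
by rewrite /box set_nil bigcap_set0 setTI size_iota mul1r.
Qed.

(** The exceptional event of the truncation at [2^j]; a union bound controls its probability. *)
Let escape j l := \bigcup_(i in [set` iota 0 l]) X i @^-1` (~` dyads R j).

Let measurable_escape j l : measurable (escape j l).
Proof.
apply: measurable_bigsetU_seq => i.
by apply: measurable_RV_preimage; exact: measurable_not_dyads.
Qed.

Let pr_escape_le j l : pr (escape j l) <= l%:R * (2 ^+ j)^-1.
Proof.
apply: (le_trans (pr_bigcup_seq_le _ _ _ _)).
  by move=> i; apply: measurable_RV_preimage; exact: measurable_not_dyads.
under eq_bigr do rewrite pr_not_dyads.
by rewrite big_const_seq count_predT size_iota iter_addr addr0 mulr_natl.
Qed.

Let not_escape j l w : ~ escape j l w -> forall i, i \in iota 0 l -> dyads R j (X i w).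
Proof. by move=> h i il; apply: contrapT => nd; apply: h; exists i. Qed.

Lemma partial_sumE l w : partial_sum (fun i => X i : T -> R) l w = \sum_(i <- iota 0 l) X i w.
Proof. by have := big_mkord xpredT (fun i => X i w) (n := l); rewrite /index_iota subn0. Qed.

Lemma measurable_partial_sum_gt l y :
  measurable [set w | y < partial_sum (fun i => X i : T -> R) l w].
Proof. exact: measurable_sum_gt. Qed.

Lemma dyads_sum_tail_le j l y :
  dyads_sum_tail j l y <= pr [set w | y < partial_sum (fun i => X i : T -> R) l w].
Proof.
rewrite dyads_sum_tailE; apply: pr_le => [||w [_]].
- exact: measurable_dyads_sum_gt.
- exact: measurable_partial_sum_gt.
by rewrite /= partial_sumE.
Qed.

Lemma pr_partial_sum_gt_le j l y :
  pr [set w | y < partial_sum (fun i => X i : T -> R) l w] <=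
  dyads_sum_tail j l y + l%:R * (2 ^+ j)^-1.
Proof.
have mS := measurable_dyads_sum_gt j (iota 0 l) y.
rewrite dyads_sum_tailE.
apply: (le_trans _ (lerD (lexx _) (pr_escape_le j l))).
apply: (le_trans _ (pr_setU_le _ _ _ _ _)) => //.
apply: pr_le => [||w /=].
- exact: measurable_partial_sum_gt.
- exact: measurableU.
rewrite partial_sumE => yw.
have [esc|/not_escape nesc] := pselect (escape j l w); [by right|by left].
Qed.

Lemma dyads_sum_tail_le1 j l (y : R) : dyads_sum_tail j l y <= 1.
Proof. by rewrite dyads_sum_tailE pr_le1//; exact: measurable_dyads_sum_gt. Qed.

Lemma dyads_sum_tailN1_ge j l : 1 - l%:R * (2 ^+ j)^-1 <= dyads_sum_tail j l (-1 : R).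
Proof.
rewrite dyads_sum_tailE lerBlDr -[leLHS](pr_setT P).
apply: (le_trans _ (lerD (lexx _) (pr_escape_le j l))).
have mS := measurable_dyads_sum_gt j (iota 0 l) (-1).
apply: (le_trans _ (pr_setU_le _ _ _ _ _)) => //.
apply: pr_le => // [|w _]; first exact: measurableU.
have [esc|/not_escape nesc] := pselect (escape j l w); [by right|left].
by rewrite dyads_sum_gtN1.
Qed.

(** Off [escape j l] each of the [l] terms is at most [2^j], so the sum cannot exceed [y]. This
    removes the correction term when the fractional part stays above [delta]. *)
Lemma pr_partial_sum_gt_small j l y : l%:R * 2 ^+ j <= y ->
  pr [set w | y < partial_sum (fun i => X i : T -> R) l w] <= l%:R * (2 ^+ j)^-1.
Proof.
move=> ly; apply: (le_trans _ (pr_escape_le j l)).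
apply: pr_le => // [|w /=]; first exact: measurable_partial_sum_gt.
apply: contraPP => /not_escape nesc; apply/negP; rewrite -leNgt (le_trans _ ly)//.
rewrite partial_sumE big_seq.
apply: (@le_trans _ _ (\sum_(i <- iota 0 l | i \in iota 0 l) 2 ^+ j)).
  by apply: ler_sum => i /nesc; exact: dyads_le.
by rewrite -big_seq big_const_seq count_predT size_iota iter_addr addr0 mulr_natl.
Qed.

(** The subset characterization makes the event a finite intersection of events on ordinary sums. *)
Lemma measurable_trimmed_sum_gt n r x : (r < n)%N ->
  measurable [set w | x < trimmed_sum (fun i => X i : T -> R) n r w].
Proof.
move=> rn.
have -> : [set w | x < trimmed_sum (fun i => X i : T -> R) n r w] =
    \bigcap_(B in [set B : {set 'I_n} | #|B| = (n - r)%N])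
      [set w | x < \sum_(i <- enum B) X (val i) w].
  apply/seteqP; split => w /=.
    by move=> /(lt_trimmed_sumP _ _ _ _ _ _ _ rn) h B cB; rewrite /= big_enum; exact: h.
  move=> h; apply/(lt_trimmed_sumP _ _ _ _ _ _ _ rn) => B cB.
  by have := h B cB; rewrite /= big_enum.
apply: fin_bigcap_measurable => [|B _]; first exact: finite_finset.
exact: measurable_sum_gt.
Qed.

End petersburg.

(** * Quantitative tail estimates *)

Section tail_estimates.
Context {R : realType} {d : measure_display} {T : measurableType d}.
Context {P : probability T R} {X : nat -> {RV P >-> R}}.
Context (hdist : forall (i k : nat), (0 < k)%N ->
  P (X i @^-1` [set 2 ^+ k]) = ((2 ^+ k)^-1)%:E).
Context (hind : mutually_independent P (fun i => (X i : T -> R))).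

Local Notation pr A := (fine (P A)).
Local Notation trimmed_gt n r x := [set w | x < trimmed_sum (fun i => X i : T -> R) n r w].
Local Notation sum_gt l y := [set w | y < partial_sum (fun i => X i : T -> R) l w].

(** Off the null set [N] of non-dyadic outcomes, the event contains the union [E] of the top events
    and is contained in [E] together with [F], where [r+2] values exceed [2^(k-n)]. *)
Lemma pr_trimmed_sum_sandwich n r k (x : R) :
  (r < n)%N -> (n <= k)%N -> 2 ^+ k.+1 <= x < 2 ^+ k.+2 ->
  let main := ('C(n, r.+1))%:R * (((2 ^+ k.+1)^-1) ^+ r.+1 *
    (dyads_sum_tail k (n - r.+1) (-1) +
     (2 ^+ r.+1 - 1) * dyads_sum_tail k (n - r.+1) (x - 2 ^+ k.+1))) in
  main <= pr (trimmed_gt n r x) <=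
  main + ('C(n, r.+2))%:R * ((2 ^+ (k - n))^-1) ^+ r.+2.
Proof.
move=> rn nk xk; cbv zeta; set main := ('C(n, r.+1))%:R * _; pose y := x - 2 ^+ k.+1.
pose subsets m := enum [set A : {set 'I_n} | #|A| == m]%SET.
have mem_subsets m (A : {set 'I_n}) : (A \in subsets m) = (#|A| == m).
  by rewrite mem_enum inE.
have sum_subsets m (c : R) : \sum_(A <- subsets m) c = ('C(n, m))%:R * c.
  by rewrite big_enum /= sumr_const card_draws card_ord mulr_natl.
pose N := \bigcup_(i in [set` iota 0 n]) X i @^-1` (~` all_dyads R).
have mNi i : measurable (X i @^-1` (~` all_dyads R)).
  by apply: measurable_RV_preimage; apply: measurableC; exact: measurable_all_dyads.
have mN : measurable N by exact: measurable_bigsetU_seq.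
have prN : pr N = 0.
  apply/eqP; rewrite eq_le pr_ge0 andbT (le_trans (pr_bigcup_seq_le _ _ _ mNi))//.
  by rewrite big1// => i _; rewrite pr_not_all_dyads.
have notN w : ~ N w -> forall i : 'I_n, all_dyads R (X i w).
  move=> nN i; apply: contrapT => nd; apply: nN; exists (val i) => //=.
  by rewrite mem_iota add0n ltn_ord.
pose E := \bigcup_(A in [set` subsets r.+1]) top_event (X := X) k y A.
have mE : measurable E.
  by apply: measurable_bigsetU_seq => A; exact: measurable_top_event.
have prE : pr E = main.
  rewrite pr_bigcup_seq ?enum_uniq//; first last.
  (* The union is disjoint: the outcome determines [A] as the set of indices with value outside
     [dyads R k]. *)
  - move=> A B w [Ac hA] [Bc hB]; apply/setP => i.
    have AL : forall i, i \in A -> ~ dyads R k (X i w).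
      move=> l lA; case: hA => [/(_ l lA) h|[h _]]; last exact: h.
      by move=> /(dyads_sub _ _ _ (leqnSn k)).
    have BL : forall i, i \in B -> ~ dyads R k (X i w).
      move=> l lB; case: hB => [/(_ l lB) h|[h _]]; last exact: h.
      by move=> /(dyads_sub _ _ _ (leqnSn k)).
    apply/idP/idP => h; apply: contraT => nh; exfalso.
      by apply: (AL _ h); exact: Bc.
    by apply: (BL _ h); exact: Ac.
  - by move=> A; exact: measurable_top_event.
  rewrite /main -sum_subsets; apply: eq_big_seq => A; rewrite mem_subsets => /eqP cA.
  exact: pr_top_event.
pose F := \bigcup_(A in [set` subsets r.+2])
  box (X := X) (ord_seq A) (fun=> ~` dyads R (k - n)).
have mFi (A : {set 'I_n}) : measurable (box (X := X) (ord_seq A) (fun=> ~` dyads R (k - n))).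
  by apply: measurable_box => _; exact: measurable_not_dyads.
have mF : measurable F by exact: measurable_bigsetU_seq.
have prF : pr F <= ('C(n, r.+2))%:R * ((2 ^+ (k - n))^-1) ^+ r.+2.
  rewrite (le_trans (pr_bigcup_seq_le _ _ _ mFi))// -sum_subsets.
  rewrite big_seq [leRHS]big_seq ler_sum// => A; rewrite mem_subsets => /eqP cA.
  have := uniq_ord_seqC A; rewrite cat_uniq => /and3P[_ _ uA].
  rewrite pr_box// => [|_]; last exact: measurable_not_dyads.
  under eq_bigr do rewrite pr_not_dyads//.
  by rewrite prod_ord_seq cA.
have mt : measurable (trimmed_gt n r x) by exact: measurable_trimmed_sum_gt.
apply/andP; split.
  rewrite -prE -[leRHS]addr0 -prN (le_trans _ (pr_setU_le _ _ _ _ _))//.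
  apply: pr_le => // [|w [A /= Asub Aw]]; first exact: measurableU.
  have [|/notN nN] := pselect (N w); [by right|left].
  apply/(lt_trimmed_sumP _ _ _ _ _ _ _ rn).
  apply: (@top_profile_gt _ n r (fun i => X i w) k x _ nN xk A) => //.
  by apply/eqP; rewrite -mem_subsets.
rewrite -prE (le_trans _ (lerD (lexx _) prF))// (le_trans _ (pr_setU_le _ _ _ _ _))//.
rewrite -[leRHS]addr0 -prN (le_trans _ (pr_setU_le _ _ _ _ _))//; last exact: measurableU.
apply: pr_le => // [|w /= tw]; first by apply: measurableU => //; exact: measurableU.
have [|/notN nN] := pselect (N w); [by right|left].
have := (lt_trimmed_sumP _ _ _ _ _ _ _ rn).1 tw.
move=> /(@gt_top_profile _ n r (fun i => X i w) k x rn nN xk nk)[[A cA hA]|[A cA hA]].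
  right; exists A; first by rewrite /= mem_subsets cA.
  by move=> _ /mapP[i + ->] /=; rewrite mem_enum => /hA.
by left; exists A => //=; rewrite mem_subsets cA.
Qed.

Lemma pr_trimmed_sum_approx n r : (r < n)%N ->
  exists2 K : R, 0 <= K & forall k x, (n <= k)%N -> 2 ^+ k.+1 <= x < 2 ^+ k.+2 ->
    `| pr (trimmed_gt n r x) * (2 ^+ k.+1) ^+ r.+1 -
       ('C(n, r.+1))%:R * (1 + pr (sum_gt (n - r.+1) (x - 2 ^+ k.+1)) * (2 ^+ r.+1 - 1)) |
    <= K * (2 ^+ k.+1)^-1.
Proof.
move=> rn; set l := (n - r.+1)%N; set C1 : R := ('C(n, r.+1))%:R.
(* With [u = 2^-(k+1)], the inverse of [2^(k-n)] is [2^(n+1) u]. Of its [r+2] factors [u], the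
   normalization cancels [r+1]. *)
pose C2 : R := ('C(n, r.+2))%:R * (2 ^+ n.+1) ^+ r.+2.
have C10 : 0 <= C1 by exact: ler0n.
have C20 : 0 <= C2 by rewrite mulr_ge0// exprn_ge0// exprn_ge0.
have l0 : 0 <= l%:R :> R by exact: ler0n.
(* The first term accounts for [r+2] large values. The second accounts for replacing [q0] by [1] and
   [q] by [pS]: each costs at most [2 l u], with weights [1] and [2^(r+1) - 1]. *)
exists (C2 + C1 * 2 ^+ r.+1 * (l%:R * 2)).
  by rewrite addr_ge0// !mulr_ge0// exprn_ge0.
move=> k x nk xk.
have /andP[] := pr_trimmed_sum_sandwich _ _ _ _ rn nk xk.
rewrite -/l -/C1; set y := x - 2 ^+ k.+1.
set pt := pr _; set pS := pr _.
set q0 := dyads_sum_tail k l (-1); set q := dyads_sum_tail k l y.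
have q01 : q0 <= 1 by exact: (dyads_sum_tail_le1 hdist hind).
have q0ge : 1 - l%:R * (2 ^+ k)^-1 <= q0 by exact: (dyads_sum_tailN1_ge hdist hind).
have qpS : q <= pS by exact: dyads_sum_tail_le.
have pSq : pS <= q + l%:R * (2 ^+ k)^-1 by exact: pr_partial_sum_gt_le.
set w : R := 2 ^+ k.+1; set u := w^-1.
have w0 : 0 < w by rewrite exprn_gt0.
have uw : u * w = 1 by rewrite mulVf// gt_eqF.
have u0 : 0 < u by rewrite invr_gt0.
have uk : (2 ^+ k)^-1 = 2 * u.
  by rewrite /u /w exprS invfM mulrA divff ?mul1r// pnatr_eq0.
have ukn : (2 ^+ (k - n))^-1 = 2 ^+ n.+1 * u.
  by rewrite /u /w -{2}(subnKC nk) -addSn exprD invfM mulrA divff ?mul1r//.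
rewrite uk in q0ge pSq; rewrite ukn.
set p := w ^+ r.+1; set a : R := 2 ^+ r.+1 - 1.
have p0 : 0 < p by rewrite exprn_gt0.
have up : u ^+ r.+1 * p = 1 by rewrite -exprMn uw expr1n.
have a0 : 0 <= a by rewrite subr_ge0 exprn_ege1// ler1n.
have e1 : C1 * (u ^+ r.+1 * (q0 + a * q)) * p = C1 * (q0 + a * q).
  rewrite [LHS](_ : _ = (u ^+ r.+1 * p) * (C1 * (q0 + a * q))); first by rewrite up mul1r.
  by move: (u ^+ r.+1) => U; ring.
have e2 : ('C(n, r.+2))%:R * (2 ^+ n.+1 * u) ^+ r.+2 * p = C2 * u.
  by rewrite exprMn [u ^+ _]exprS /C2 -!mulrA; do 3!congr (_ * _); rewrite up mulr1.
move=> /(ler_wpM2r (ltW p0)); rewrite e1 => lo.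
move=> /(ler_wpM2r (ltW p0)); rewrite mulrDl e1 e2 => hi.
have -> : 2 ^+ r.+1 = a + 1 by rewrite /a subrK.
have h1 : 0 <= a * (pS - q) by rewrite mulr_ge0// subr_ge0.
have h2 : a * (pS - q) <= a * (l%:R * (2 * u)) by rewrite ler_wpM2l// lerBlDl.
have h3 : C1 * (q0 + a * q) <= C1 * (1 + pS * a).
  by rewrite ler_wpM2l// lerD// [leRHS]mulrC ler_wpM2l.
have h4 : C1 * (1 + pS * a) - C1 * (q0 + a * q) <= C1 * ((a + 1) * (l%:R * (2 * u))).
  by rewrite -mulrBr ler_wpM2l//; lra.
have h5 : 0 <= C2 * u by rewrite mulr_ge0// ltW.
have h6 : 0 <= C1 * ((a + 1) * (l%:R * (2 * u))).
  have u0' := ltW u0; by rewrite !mulr_ge0// addr_ge0.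
have -> : (C2 + C1 * (a + 1) * (l%:R * 2)) * u =
  C2 * u + C1 * ((a + 1) * (l%:R * (2 * u))) by ring.
by rewrite ler_norml; apply/andP; split; lra.
Qed.

End tail_estimates.

(** * Fractional part of the binary logarithm *)

Lemma log2_decomposition {R : realType} (x : R) : 1 <= x ->
  exists m, [/\ 2 ^+ m <= x, x < 2 ^+ m.+1 & 2 `^ fracpart (log2 x) = x / 2 ^+ m].
Proof.
move=> x1; have x0 : 0 < x by exact: lt_le_trans x1.
have ln2 : 0 < ln 2 :> R by rewrite ln_gt0// ltr1n.
have L0 : 0 <= log2 x by rewrite divr_ge0 ?ln_ge0// ler1n.
have fl0 : (0 <= Num.floor (log2 x)) by rewrite floor_ge0.
exists `|Num.floor (log2 x)|%N.
have E : (Num.floor (log2 x))%:~R = (`|Num.floor (log2 x)|%N)%:R :> R.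
  by rewrite -[in LHS](gez0_abs fl0).
set m := `|_|%N in E *.
have x2 : 2 `^ log2 x = x.
  by rewrite /powR pnatr_eq0 /= /log2 mulrAC -mulrA divff ?gt_eqF// mulr1 lnK// posrE.
have := floor_itv (log2 x); rewrite intrD E => /andP[h1 h2].
split.
- by rewrite -[leRHS]x2 -powR_mulrn// ler_powR// ler1n.
- rewrite -[ltLHS]x2 /powR pnatr_eq0 /= -[ltRHS]lnK ?posrE ?exprn_gt0// ltr_expR.
  by rewrite lnXn// -[ltRHS]mulr_natl ltr_pM2r// -addn1 natrD.
- by rewrite /fracpart E powRB ?pnatr_eq0 ?implybT// x2 powR_mulrn.
Qed.

(** * Passage to the limit *)

Theorem theorem1 (R : realType) (d : measure_display) (T : measurableType d)
  (P : probability T R) (X : nat -> {RV P >-> R})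
  (hdist : forall (i k : nat), (0 < k)%N ->
     P (X i @^-1` [set 2 ^+ k]) = ((2 ^+ k)^-1)%:E)
  (hind : mutually_independent P (fun i => (X i : T -> R)))
  (n r : nat) (hrn : (r < n)%N) :
  ((fun x : R =>
      fine (P [set w | x < trimmed_sum (fun i => (X i : T -> R)) n r w]) /
      ((2 `^ (r.+1%:R * fracpart (log2 x)) / x ^+ r.+1) * ('C(n, r.+1))%:R *
       (1 + fine (P [set w | x * (1 - 2 `^ (- fracpart (log2 x))) <
                             partial_sum (fun i => (X i : T -> R)) (n - r.+1) w])
            * (2 ^+ r.+1 - 1))))
     @ +oo --> (1 : R))
  /\
  (forall delta : R, 0 < delta < 1 ->
   forall eps : R, 0 < eps ->
   exists M : R, forall x : R, M < x -> delta < fracpart (log2 x) ->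
     `| fine (P [set w | x < trimmed_sum (fun i => (X i : T -> R)) n r w])
          * x ^+ r.+1 / 2 `^ (r.+1%:R * fracpart (log2 x))
        - ('C(n, r.+1))%:R | < eps).
Proof.
have [K K0 approx] := pr_trimmed_sum_approx hdist hind n r hrn.
pose a : R := 2 ^+ r.+1 - 1.
have a0 : 0 <= a by rewrite subr_ge0 exprn_ege1// ler1n.
pose C : R := ('C(n, r.+1))%:R.
have C1 : 1 <= C by rewrite ler1n bin_gt0.
pose l := (n - r.+1)%N.
pose p x := fine (P [set w | x < trimmed_sum (fun i => (X i : T -> R)) n r w]).
pose ps y := fine (P [set w | y < partial_sum (fun i => (X i : T -> R)) l w]).
(* Here [u = 2^-(k+1)] replaces the fractional parts. The bound [u <= 2 / x], from [x < 2^(k+2)],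
   makes the error [K * u] vanish at infinity. *)
have scale (x : R) : 2 ^+ n.+1 <= x -> exists2 u : R, 0 < u <= 2 / x &
    [/\ x ^+ r.+1 / 2 `^ (r.+1%:R * fracpart (log2 x)) = (u^-1) ^+ r.+1,
        2 `^ (- fracpart (log2 x)) = (x * u)^-1 &
        `| p x * (u^-1) ^+ r.+1 -
           C * (1 + ps (x * (1 - 2 `^ (- fracpart (log2 x)))) * a) | <= K * u].
  move=> xn; have x1 : 1 <= x by rewrite (le_trans _ xn)// exprn_ege1// ler1n.
  have x0 : 0 < x by exact: lt_le_trans x1.
  have [m [mx xm frac]] := log2_decomposition x x1.
  (* The value [m = 0] would give [2^(n+1) <= x < 2]. *)
  have [k mk] : exists k, m = k.+1.
    case: m mx xm {frac} => [|k _ _]; last by exists k.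
    move=> _; rewrite expr1 => /(le_lt_trans xn).
    by rewrite -{2}[2]expr1 ltr_eXn2l ?ltr1n.
  subst m.
  have nk : (n <= k)%N.
    by have := le_lt_trans xn xm; rewrite ltr_eXn2l ?ltr1n// !ltnS.
  have w0 : 0 < 2 ^+ k.+1 :> R by rewrite exprn_gt0.
  exists (2 ^+ k.+1)^-1.
    rewrite invr_gt0 w0 /= ler_pdivlMr// ler_pdivrMl// mulrC -exprS ltW//.
  have fracN : 2 `^ (- fracpart (log2 x)) = (x * (2 ^+ k.+1)^-1)^-1.
    by rewrite powRN frac.
  rewrite invrK; split=> //.
    rewrite [r.+1%:R * _]mulrC powRrM frac powR_mulrn; last by rewrite divr_ge0// ltW.
    by rewrite expr_div_n invfM invrK mulrA divff ?mul1r// expf_neq0// gt_eqF.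
  have -> : x * (1 - 2 `^ (- fracpart (log2 x))) = x - 2 ^+ k.+1.
    by rewrite fracN invfM invrK mulrBr mulr1 mulrA divff ?mul1r// gt_eqF.
  by apply: approx => //; rewrite mx xm.
split.
  apply/cvgrPdist_le => e e0.
  near=> x.
  have xn : 2 ^+ n.+1 <= x by near: x; exact: nbhs_pinfty_ge.
  (* This gives [K * u <= 2 K / x <= e], which also bounds the relative error because [C * D] is at
     least [1]. *)
  have xK : e^-1 * (K * 2) <= x by near: x; apply: nbhs_pinfty_ge; exact: num_real.
  have [u /andP[u0 ux] [xr _ hu]] := scale x xn.
  have x0 : 0 < x by rewrite (lt_le_trans _ xn)// exprn_gt0.
  rewrite -/a -/(ps _) -/(p _) -/C.
  move: hu; set D := 1 + ps _ * a => hu.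
  have D1 : 1 <= D by rewrite lerDl mulr_ge0// pr_ge0.
  have CD1 : 1 <= C * D by rewrite -[leLHS]mulr1 ler_pM.
  have -> : 2 `^ (r.+1%:R * fracpart (log2 x)) / x ^+ r.+1 = u ^+ r.+1.
    by apply: invr_inj; rewrite invf_div xr exprVn.
  rewrite -mulrA invfM mulrA -exprVn.
  have CD0 : C * D != 0 by rewrite gt_eqF// (lt_le_trans ltr01).
  rewrite -[X in `|X - _|](divff CD0) -mulrBl normrM distrC.
  rewrite [X in _ * X]ger0_norm; last by rewrite invr_ge0 (le_trans ler01).
  rewrite ler_pdivrMr; last by rewrite (lt_le_trans ltr01).
  apply: (le_trans hu); apply: (@le_trans _ _ e); last by rewrite ler_peMr// ltW.
  by rewrite (le_trans (ler_wpM2l K0 ux))// mulrA ler_pdivrMr// -ler_pdivrMl.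
move=> delta /andP[d0 d1] eps eps0.
(* This [j] brings the correction term, at most [C a l / 2^j], below [eps / 2]. *)
have [j jeps] := exists_expn2_gt (C * a * l%:R * 2 / eps).
have s0 : 0 < 1 - 2 `^ (- delta) :> R.
  rewrite subr_gt0 powRN invf_lt1 ?powR_gt0//.
  by rewrite /powR pnatr_eq0 /= -[ltLHS]expR0 ltr_expR mulr_gt0// ln_gt0// ltr1n.
(* The three bounds make [scale] applicable, ensure [l 2^j <= y] once the fractional part exceeds
   [delta], and give [K * u < eps / 2]. *)
exists (Num.max (2 ^+ n.+1) (Num.max (l%:R * 2 ^+ j / (1 - 2 `^ (- delta))) (4 * K / eps))).
move=> x; rewrite !gt_max => /andP[/ltW xn /andP[xs xK]] dx.
have [u /andP[u0 ux] [xr _ hu]] := scale x xn.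
have x0 : 0 < x by rewrite (lt_le_trans _ xn)// exprn_gt0.
rewrite -mulrA xr -/(p _) -/C.
move: hu; set y := x * _ => hu.
have small : ps y <= l%:R * (2 ^+ j)^-1.
  apply: (pr_partial_sum_gt_small hdist).
  rewrite ltr_pdivrMr// in xs; apply: (le_trans (ltW xs)).
  rewrite ler_pM2l// lerB// ler_powR ?ler1n// lerN2 ltW//.
have h1 : C * (ps y * a) < eps / 2.
  apply: (@le_lt_trans _ _ (C * (l%:R * (2 ^+ j)^-1 * a))).
    by rewrite ler_wpM2l ?ler_wpM2r// (le_trans ler01).
  have -> : C * (l%:R * (2 ^+ j)^-1 * a) = C * a * l%:R / 2 ^+ j by ring.
  rewrite ltr_pdivrMr ?exprn_gt0//; rewrite ltr_pdivrMr// in jeps; lra.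
have h2 : K * u < eps / 2.
  apply: (le_lt_trans (ler_wpM2l K0 ux)).
  rewrite mulrA ltr_pdivrMr//; rewrite ltr_pdivrMr// in xK; lra.
have h3 : 0 <= C * (ps y * a).
  by rewrite !mulr_ge0 ?pr_ge0// (le_trans ler01).
move: hu; rewrite mulrDr mulr1 ler_norml ltr_norml => /andP[lo hi].
by apply/andP; split; lra.
Unshelve. all: by end_near.
Qed.
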